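(* Let $R$ be a ring, let $\mathcal C$ be a full subcategory of $\operatorname{Mod-}R$ all of whose objects are indecomposable right $R$-modules, and let $\mathcal P,\mathcal Q$ be completely prime ideals of $\mathcal C$ such that for every $A\in\operatorname{Ob}(\mathcal C)$ an endomorphism $f\colon A\to A$ is an automorphism if and only if $f\notin\mathcal P(A,A)\cup\mathcal Q(A,A)$. Assume $\mathcal C$ satisfies Condition (DSP). Let $\{A_i\mid i\in I\}$ and $\{B_j\mid j\in J\}$ be families of objects of $\mathcal C$, and assume there exist bijections $\sigma,\tau\colon I\to J$ with $[A_i]_{\mathcal P}=[B_{\sigma(i)}]_{\mathcal P}$ and $[A_i]_{\mathcal Q}=[B_{\tau(i)}]_{\mathcal Q}$ for every $i\in I$. Then $\prod_{i\in I}A_i\cong\prod_{j\in J}B_j$ as $R$-modules.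
   Context: A completely prime ideal $\mathcal P$ of a full subcategory $\mathcal C$ of $\operatorname{Mod-}R$ consists of a subgroup $\mathcal P(A,B)$ of $\operatorname{Hom}_R(A,B)$ for each pair of objects $A,B$ of $\mathcal C$ such that: (1) for all objects $A,B,C$ and morphisms $f\colon A\to B$, $g\colon B\to C$, one has $gf\in\mathcal P(A,C)$ if and only if $f\in\mathcal P(A,B)$ or $g\in\mathcal P(B,C)$; (2) $\mathcal P(A,A)\neq\operatorname{Hom}_R(A,A)$ for every object $A$. For objects $A,B$, write $[A]_{\mathcal P}=[B]_{\mathcal P}$ (''same $\mathcal P$ class'') if $\mathcal P(A,B)\ne\operatorname{Hom}_R(A,B)$ and $\mathcal P(B,A)\neq\operatorname{Hom}_R(B,A)$. $\mathcal C$ satisfies Condition (DSP) if whenever $A,B,C,D$ are right $R$-modules with $A\oplus B\cong C\oplus D$ and $A,B,C\in\operatorname{Ob}(\mathcal C)$, then $D\in\operatorname{Ob}(\mathcal C)$. *)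

(* Defs.v *)
From HB Require Import structures.
From mathcomp Require Import all_boot all_order all_algebra.
Set Implicit Arguments. Unset Strict Implicit. Unset Printing Implicit Defensive.
Import GRing.Theory.
Local Open Scope ring_scope.

(* Right R-modules are modelled as left modules over the converse ring R^c;
   R-homomorphisms U -> V are {linear U -> V}. *)
Notation rmodType R := (lmodType R^c).

Definition mod_iso (R : pzRingType) (U V : rmodType R) : Prop :=
  exists f : {linear U -> V}, bijective f.

Definition trivial_mod (R : pzRingType) (U : rmodType R) : Prop :=
  forall x : U, x = 0.

Definition indecomposable (R : pzRingType) (U : rmodType R) : Prop :=
  ~ trivial_mod U /\
  forall V W : rmodType R, mod_iso U (V * W)%type ->
    trivial_mod V \/ trivial_mod W.

(* A (pre)ideal assignment on a full subcategory: for each pair of modules a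
   predicate on maps (only its values on homomorphisms between objects matter). *)
Definition ideal_data (R : pzRingType) :=
  forall U V : rmodType R, (U -> V) -> Prop.

Definition completely_prime (R : pzRingType) (Ob : rmodType R -> Prop)
    (P : ideal_data R) : Prop :=
  (forall A B : rmodType R, Ob A -> Ob B ->
      P A B (fun _ => 0) /\
      forall f g : {linear A -> B}, P A B f -> P A B g ->
        P A B (fun x => f x - g x)) /\
  (forall A B C : rmodType R, Ob A -> Ob B -> Ob C ->
      forall (f : {linear A -> B}) (g : {linear B -> C}),
        P A C (fun x => g (f x)) <-> (P A B f \/ P B C g)) /\
  (forall A : rmodType R, Ob A -> exists f : {linear A -> A}, ~ P A A f).

Definition ideal_ne_hom (R : pzRingType) (P : ideal_data R)
    (A B : rmodType R) : Prop :=
  exists f : {linear A -> B}, ~ P A B f.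

Definition same_class (R : pzRingType) (P : ideal_data R)
    (A B : rmodType R) : Prop :=
  ideal_ne_hom P A B /\ ideal_ne_hom P B A.

Definition DSP (R : pzRingType) (Ob : rmodType R -> Prop) : Prop :=
  forall A B C D : rmodType R,
    mod_iso (A * B)%type (C * D)%type -> Ob A -> Ob B -> Ob C -> Ob D.

Definition prod_iso (R : pzRingType) (I J : Type)
    (A : I -> rmodType R) (B : J -> rmodType R) : Prop :=
  exists f : (forall i, A i) -> (forall j, B j),
    bijective f /\
    (forall x y : forall i, A i,
        f (fun i => x i + y i) = (fun j => f x j + f y j)) /\
    (forall (a : R^c) (x : forall i, A i),
        f (fun i => a *: x i) = (fun j => a *: f x j)).

(* Main.v *)
Require Import Defs.
From HB Require Import structures.
From mathcomp Require Import all_boot all_order all_algebra.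
From mathcomp Require Import boolp.
Import GRing.Theory.
Local Open Scope ring_scope.

(** Identify J with I through sigma, so that A_i and B_i have the same P-class
    and A_i has the Q-class of B_(t i) for a permutation t.  By (DSP), the
    complement of an object C in A (+) B, where C has the P-class of A and the
    Q-class of B, is an object with the P-class of B and the Q-class of A; hence
    every pair (P-class of B_i, Q-class of B_j) with i, j in the same t-orbit is
    realised by an object.  Let r be an involution preserving the t-orbits with
    r t r = t^-1 and let C_i realise the pair (i, r i).  Then C and B differ by
    the involution r on Q-classes, A and C by the involution t^-1 r; families
    differing by an involution have isomorphic products, because the direct
    sums over its orbits, which have at most two elements, are isomorphic. *)

(** * Linear maps and module isomorphisms *)

Definition lin (R : pzRingType) (U V : rmodType R) (f : U -> V)
    (f_lin : linear f) : {linear U -> V} :=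
  HB.pack f (GRing.isLinear.Build R^c U V *:%R f f_lin).
Arguments lin {R U V f} f_lin.

Section ModIso.
Context (R : pzRingType).
Implicit Types U V W : rmodType R.

Lemma mod_isoP U V (f : {linear U -> V}) (g : V -> U) :
  cancel f g -> cancel g f -> mod_iso U V.
Proof. by move=> fK gK; exists f; exists g. Qed.

Lemma mod_iso_refl U : mod_iso U U.
Proof. by apply: (@mod_isoP U U idfun id). Qed.

Lemma mod_iso_sym U V : mod_iso U V -> mod_iso V U.
Proof.
move=> [f [g fK gK]].
exact: (@mod_isoP V U (lin (can2_linear fK gK)) f).
Qed.

Lemma mod_iso_trans V U W : mod_iso U V -> mod_iso V W -> mod_iso U W.
Proof.
move=> [f bij_f] [g bij_g]; exists (g \o f : {linear U -> W}).
exact: bij_comp.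
Qed.

Lemma mod_iso_pairC U V : mod_iso (U * V)%type (V * U)%type.
Proof.
have l : linear (fun x : U * V => (x.2, x.1)) by [].
by apply: (@mod_isoP _ _ (lin l) (fun x => (x.2, x.1))); case.
Qed.

Lemma mod_iso_pair U U' V V' : mod_iso U U' -> mod_iso V V' ->
  mod_iso (U * V)%type (U' * V')%type.
Proof.
move=> [f [f' fK f'K]] [g [g' gK g'K]].
have l : linear (fun x : U * V => (f x.1, g x.2)).
  by move=> a x y /=; rewrite !linearP.
apply: (@mod_isoP _ _ (lin l) (fun x => (f' x.1, g' x.2))).
  by case=> x y /=; rewrite fK gK.
by case=> x y /=; rewrite f'K g'K.
Qed.

End ModIso.

(** * Kernels and split direct summands *)

Definition ker_pred (R : pzRingType) (U V : rmodType R) (h : {linear U -> V}) :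
  {pred U} := [pred x | h x == 0].

Fact ker_submod_closed (R : pzRingType) (U V : rmodType R)
  (h : {linear U -> V}) : submod_closed (ker_pred R U V h).
Proof.
split=> [|a x y]; rewrite !inE ?linear0 // linearP => /eqP-> /eqP->.
by rewrite scaler0 addr0.
Qed.

HB.instance Definition _ (R : pzRingType) (U V : rmodType R)
  (h : {linear U -> V}) :=
  GRing.isSubmodClosed.Build R^c U (ker_pred R U V h)
    (ker_submod_closed R U V h).

Record ker (R : pzRingType) (U V : rmodType R) (h : {linear U -> V}) :=
  Ker { ker_val :> U; _ : ker_val \in ker_pred R U V h }.

HB.instance Definition _ (R : pzRingType) (U V : rmodType R)
  (h : {linear U -> V}) := [isSub for @ker_val R U V h].
HB.instance Definition _ (R : pzRingType) (U V : rmodType R)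
  (h : {linear U -> V}) := [Choice of ker R U V h by <:].
HB.instance Definition _ (R : pzRingType) (U V : rmodType R)
  (h : {linear U -> V}) := [SubChoice_isSubLmodule of ker R U V h by <:].

(** With [k] inverse to [h \o e], the map [e \o k \o h] is an idempotent with image [e C] and kernel
    that of [h], so the latter serves as complement. *)
Lemma split_summand (R : pzRingType) (C U : rmodType R)
    (e : {linear C -> U}) (h : {linear U -> C}) :
  bijective (h \o e) -> exists D : rmodType R, mod_iso U (C * D)%type.
Proof.
move=> [k heK kK]; exists (ker R U C h); apply: mod_iso_sym.
have hek u : h (e (k u)) = u by exact: kK.
have l : linear (fun x : C * ker R U C h => e x.1 + ker_val _ _ _ _ x.2).
  by move=> a x y /=; rewrite linearP scalerDr addrACA.
have hP u : u - e (k (h u)) \in ker_pred R U C h.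
  by rewrite inE linearB /= hek subrr.
apply: (@mod_isoP _ _ _ (lin l)
         (fun u => (k (h u), Ker _ _ _ _ _ (hP u)))).
  move=> [c [d hd]] /=.
  have khe : k (h (e c + d)) = c.
    by move: (hd); rewrite inE linearD => /eqP->; rewrite addr0; exact: heK.
  congr pair; first exact: khe.
  by apply: val_inj; rewrite /= khe addrC addKr.
by move=> u /=; rewrite addrC subrK.
Qed.

(** * Ideal classes *)

Section Classes.
Context (R : pzRingType) (Ob : rmodType R -> Prop) (P : ideal_data R).
Context (HP : completely_prime Ob P).
Arguments P {_ _}.
Implicit Types A B C D X : rmodType R.

Lemma ideal_add A B (f g : {linear A -> B}) : Ob A -> Ob B ->
  P f -> P g -> P (f \+ g).
Proof.
move=> oA oB Pf Pg; have [/(_ A B oA oB)[P0 sub] _] := HP.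
(* The ideal is assumed closed under differences only, so [f + g] is reached as [f - (0 - g)]. *)
have PN : P (\0 \- g : {linear A -> B}) by exact: (sub \0 g P0 Pg).
have := sub f (\0 \- g) Pf PN; congr P; apply: funext => x /=.
by rewrite sub0r opprK.
Qed.

Lemma nideal_comp A B C (f : {linear A -> B}) (g : {linear B -> C}) :
  Ob A -> Ob B -> Ob C -> ~ P (g \o f) <-> ~ P f /\ ~ P g.
Proof.
move=> oA oB oC; have [_ [/(_ A B C oA oB oC f g) H _]] := HP.
by rewrite [P _](propext H); split=> [/not_orP|[? ?] []].
Qed.

Lemma nideal_add A B (f g : {linear A -> B}) : Ob A -> Ob B ->
  P f -> ~ P g -> ~ P (f \+ g).
Proof.
move=> oA oB Pf nPg PD; apply: nPg; have [/(_ A B oA oB)[_ sub] _] := HP.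
have := sub (f \+ g) f PD Pf; congr P; apply: funext => x /=.
by rewrite addrC addKr.
Qed.

Lemma nideal_addr A B (f g : {linear A -> B}) : Ob A -> Ob B ->
  ~ P f -> P g -> ~ P (f \+ g).
Proof.
move=> oA oB nPf Pg; have := nideal_add A B g f oA oB Pg nPf.
by congr (~ P _); apply: funext => x /=; rewrite addrC.
Qed.

Lemma nideal_id A : Ob A -> ~ P (@idfun A).
Proof.
move=> oA; have [_ [_ /(_ A oA)[f nPf]]] := HP.
by have /(nideal_comp A A A idfun f oA oA oA)[] : ~ P (f \o idfun) by [].
Qed.

Lemma same_class_refl A : Ob A -> same_class (@P) A A.
Proof. by move=> oA; split; exists idfun; exact: nideal_id. Qed.

Lemma same_class_sym A B : same_class (@P) A B -> same_class (@P) B A.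
Proof. by case. Qed.

Lemma same_class_trans B A C : Ob A -> Ob B -> Ob C ->
  same_class (@P) A B -> same_class (@P) B C -> same_class (@P) A C.
Proof.
move=> oA oB oC [[f nf] [f' nf']] [[g ng] [g' ng']]; split.
  by exists (g \o f); apply/nideal_comp.
by exists (f' \o g'); apply/nideal_comp.
Qed.

(** The identity of [X] is the sum of its parts through [C] and [D]. It lies outside the ideal,
    hence so does one part, and then both factors of that part. *)
Lemma summand_class X C D (i : {linear X -> (C * D)%type})
    (q : {linear (C * D)%type -> X}) : Ob X -> Ob C -> Ob D ->
  cancel i q -> same_class (@P) X C \/ same_class (@P) X D.
Proof.
move=> oX oC oD iK.
have l1 : linear (fun x => (i x).1) by move=> a x y; rewrite linearP.
have l2 : linear (fun x => (i x).2) by move=> a x y; rewrite linearP.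
have m1 : linear (fun c : C => q (c, 0)).
  by move=> a x y; rewrite -linearP; congr (q _);
    congr pair; rewrite /= scaler0 addr0.
have m2 : linear (fun d : D => q (0, d)).
  by move=> a x y; rewrite -linearP; congr (q _);
    congr pair; rewrite /= scaler0 addr0.
pose i1 := lin l1; pose i2 := lin l2.
pose q1 := lin m1; pose q2 := lin m2.
have idE : idfun = (q1 \o i1) \+ (q2 \o i2) :> (X -> X).
  apply: funext => x /=; rewrite -linearD -{1}[x]iK; congr (q _).
  by case: (i x) => c d; congr pair; rewrite /= ?addr0 ?add0r.
have [P1|nP1] := EM (P (q1 \o i1)).
  have [P2|/nideal_comp[] // ni nq] := EM (P (q2 \o i2)).
    by case: (nideal_id X oX); rewrite idE; exact: ideal_add.
  by right; split; [exists i2 | exists q2].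
by left; move: nP1 => /nideal_comp[] // ni nq; split; [exists i1 | exists q1].
Qed.

End Classes.

(** [B] is a summand of [C * D], so it has the class of [D], as wanted, or of [C]. In the second
    case [D], a summand of [A * B], has the class of [B] or of [A], and all four classes coincide in
    the latter case. *)
Lemma summand_class_cancel (R : pzRingType) (Ob : rmodType R -> Prop)
    (P : ideal_data R) (A B C D : rmodType R) :
  completely_prime Ob P -> Ob A -> Ob B -> Ob C -> Ob D ->
  mod_iso (A * B)%type (C * D)%type ->
  same_class P A C -> same_class P B D.
Proof.
move=> HP oA oB oC oD iso AC.
have inj_l (U V : rmodType R) : linear (fun u : U => (u, 0) : (U * V)%type).
  by move=> a x y; congr pair; rewrite /= scaler0 addr0.
have inj_r (U V : rmodType R) : linear (fun v : V => (0, v) : (U * V)%type).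
  by move=> a x y; congr pair; rewrite /= scaler0 addr0.
have prj_l (U V : rmodType R) : linear (fun x : (U * V)%type => x.1) by [].
have prj_r (U V : rmodType R) : linear (fun x : (U * V)%type => x.2) by [].
have [f [g fK gK]] := iso.
pose g' := lin (can2_linear fK gK).
have tr := same_class_trans R Ob P HP.
have sy := same_class_sym R P.
have fK' : cancel (f \o lin (inj_r A B)) (lin (prj_r A B) \o g').
  by move=> x /=; rewrite fK.
have [BC|//] := summand_class R Ob P HP B C D _ _ oB oC oD fK'.
have gK' : cancel (g' \o lin (inj_r C D)) (lin (prj_r C D) \o f).
  by move=> x /=; rewrite gK.
have [DA|DB] := summand_class R Ob P HP D A B _ _ oD oA oB gK'; last exact: sy.
by apply: (tr C) => //; apply: (tr A) => //; apply: sy.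
Qed.

(** * Exchanging summands that share one class each *)

Section Exchange.
Context (R : pzRingType) (Ob : rmodType R -> Prop) (P Q : ideal_data R).
Context (HP : completely_prime Ob P) (HQ : completely_prime Ob Q).
Context (Haut : forall A : rmodType R, Ob A -> forall f : {linear A -> A},
  bijective f <-> ~ (P A A f \/ Q A A f)).
Implicit Types A B C D : rmodType R.

(** If [f] lies in [Q] only and [g] in [P] only, their sum lies in neither. *)
Lemma avoid_both A B : Ob A -> Ob B -> ideal_ne_hom P A B ->
  ideal_ne_hom Q A B -> exists f : {linear A -> B}, ~ P A B f /\ ~ Q A B f.
Proof.
move=> oA oB [f nPf] [g nQg].
have [Qf|] := EM (Q A B f); last by exists f.
have [Pg|] := EM (P A B g); last by exists g.
by exists (f \+ g); split;
  [exact: (nideal_addr R Ob P HP) | exact: (nideal_add R Ob Q HQ)].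
Qed.

(** Maps both ways avoiding [P] and [Q] have composites avoiding both, which are therefore
    automorphisms. *)
Lemma mod_iso_of_classes A B : Ob A -> Ob B ->
  same_class P A B -> same_class Q A B -> mod_iso A B.
Proof.
move=> oA oB [PAB PBA] [QAB QBA].
have [f [nPf nQf]] := avoid_both A B oA oB PAB QAB.
have [g [nPg nQg]] := avoid_both B A oB oA PBA QBA.
have [h hK _] : bijective (g \o f).
  apply/(Haut A oA); case;
    [exact/(nideal_comp R Ob P HP) | exact/(nideal_comp R Ob Q HQ)].
have [k _ kK] : bijective (f \o g).
  apply/(Haut B oB); case;
    [exact/(nideal_comp R Ob P HP) | exact/(nideal_comp R Ob Q HQ)].
apply: (@mod_isoP _ _ _ f (h \o g)) => [x|y] /=; first exact: hK.
(* The left inverse [h \o g] of [f] is also a right inverse: with [y = f (g (k y))], [h (g y)]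
   becomes [g (k y)]. *)
rewrite -[y in g y]kK /=; have /= -> := hK (g (k y)); exact: kK.
Qed.

Context (Hdsp : DSP Ob).

Lemma exchange A B C : Ob A -> Ob B -> Ob C ->
  same_class P C A -> same_class Q C B ->
  exists D, [/\ Ob D, mod_iso (A * B)%type (C * D)%type,
    same_class P D B & same_class Q D A].
Proof.
move=> oA oB oC PCA QCB.
have [[b nPb] [a nPa]] := PCA; have [[d nQd] [c nQc]] := QCB.
(* If [a \o b] avoids [Q], then [C] and [A] share both classes, so they are isomorphic and [B] is
   the complement. *)
have [Qab|nQab] := EM (Q C C (a \o b)); last first.
  have QCA : same_class Q C A.
    move: nQab => /(nideal_comp R Ob Q HQ)[] // nb na.
    by split; [exists b | exists a].
  exists B; split=> //.
  - apply: mod_iso_pair; last exact: mod_iso_refl.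
    by apply/mod_iso_sym/mod_iso_of_classes.
  - exact: (same_class_refl R Ob P HP).
  - apply: (same_class_trans R Ob Q HQ C) => //.
    exact: same_class_sym.
have [Pcd|nPcd] := EM (P C C (c \o d)); last first.
  have PCB : same_class P C B.
    move: nPcd => /(nideal_comp R Ob P HP)[] // nb na.
    by split; [exists d | exists c].
  exists A; split=> //.
  - apply: mod_iso_trans (mod_iso_pairC _ _ _) _.
    apply: mod_iso_pair; last exact: mod_iso_refl.
    by apply/mod_iso_sym/mod_iso_of_classes.
  - apply: (same_class_trans R Ob P HP C) => //.
    exact: same_class_sym.
  - exact: (same_class_refl R Ob Q HQ).
(* Now [a \o b] lies in [Q] but not [P], and [c \o d] in [P] but not [Q]. Their sum avoids both, so
   it is an automorphism of [C] factoring through [A * B]. *)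
have le : linear (fun x : C => (b x, d x)) by move=> t x y; rewrite !linearP.
have lh : linear (fun x : (A * B)%type => a x.1 + c x.2).
  by move=> t x y /=; rewrite !linearP scalerDr addrACA.
have [|D iso] := split_summand R C (A * B)%type (lin le) (lin lh).
  apply/(Haut C oC ((a \o b) \+ (c \o d))); case; last first.
    apply: (nideal_add R Ob Q HQ) => //; exact/(nideal_comp R Ob Q HQ).
  apply: (nideal_addr R Ob P HP) => //; exact/(nideal_comp R Ob P HP).
have oD : Ob D by exact: Hdsp iso oA oB oC.
exists D; split=> //; apply: same_class_sym.
  exact: (summand_class_cancel R Ob P A B C D) (same_class_sym _ _ _ _ PCA).
apply: (summand_class_cancel R Ob Q B A C D) (same_class_sym _ _ _ _ QCB) => //.
exact: mod_iso_trans (mod_iso_pairC _ _ _) iso.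
Qed.

(** The complement of [C] in [A * B] given by [exchange] has both classes of [D]. *)
Lemma swap_iso A B C D : Ob A -> Ob B -> Ob C -> Ob D ->
  same_class P A C -> same_class P B D ->
  same_class Q A D -> same_class Q B C ->
  mod_iso (A * B)%type (C * D)%type.
Proof.
move=> oA oB oC oD PAC PBD QAD QBC.
have [] // := exchange A B C oA oB oC; try exact: same_class_sym.
move=> E [oE iso PEB QEA]; apply: mod_iso_trans iso _.
apply: mod_iso_pair; first exact: mod_iso_refl.
apply: mod_iso_of_classes => //.
  exact: (same_class_trans R Ob P HP B).
exact: (same_class_trans R Ob Q HQ A).
Qed.

End Exchange.

(** * Isomorphisms of infinite products *)

Section ProdIso.
Context (R : pzRingType).

Lemma prod_iso_sym I J (A : I -> rmodType R) (B : J -> rmodType R) :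
  prod_iso A B -> prod_iso B A.
Proof.
move=> [f [[g fK gK] [fD fZ]]]; exists g; split; first by exists f.
split=> [x y|a x]; apply: (can_inj fK); rewrite gK ?fD ?fZ;
  by apply: functional_extensionality_dep => j; rewrite !gK.
Qed.

Lemma prod_iso_trans J I K (A : I -> rmodType R) (B : J -> rmodType R)
    (C : K -> rmodType R) :
  prod_iso A B -> prod_iso B C -> prod_iso A C.
Proof.
move=> [f [bij_f [fD fZ]]] [g [bij_g [gD gZ]]]; exists (g \o f).
by split; [exact: bij_comp | split=> [x y|a x] /=; rewrite ?fD ?fZ ?gD ?gZ].
Qed.

Lemma prod_iso_reindex I J (B : J -> rmodType R) (h : I -> J) :
  bijective h -> prod_iso (B \o h) B.
Proof.
move=> [g hK gK]; apply: prod_iso_sym.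
exists (fun y i => y (h i)); split; last by [].
(* The entry [x (g j)] has type [B (h (g j))] and is transported along [gK j]. *)
exists (fun x j => eq_rect _ B (x (g j)) _ (gK j)) => [y|x].
  apply: functional_extensionality_dep => j /=.
  have castE k (e : k = j) : eq_rect _ B (y k) _ e = y j by case: j / e.
  exact: castE.
apply: functional_extensionality_dep => i /=.
have castE k (e : h k = h i) : k = i ->
    eq_rect _ B (x k) _ e = x i.
  by move=> ki; subst k; rewrite (Prop_irrelevance e erefl).
exact: castE (hK i).
Qed.

(** A product over [I] is the product, over [k], of the products over the fibres of [c]; the
    fibrewise isomorphisms are glued. *)
Lemma prod_iso_gather I K (A B : I -> rmodType R) (c : I -> K) :
  (forall k, prod_iso (fun s : {i | c i = k} => A (sval s))
                      (fun s : {i | c i = k} => B (sval s))) ->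
  prod_iso A B.
Proof.
move=> /(_ _)/cid-/all_sig[f fP].
have /all_sig[g gP] k : {g | cancel (f k) g /\ cancel g (f k)}.
  by apply: cid; have [[g fK gK] _] := fP k; exists g.
pose glue (X Y : I -> rmodType R)
    (u : forall k, (forall s : {i | c i = k}, X (sval s)) ->
                   forall s : {i | c i = k}, Y (sval s))
    (x : forall i, X i) (i : I) : Y i :=
  u (c i) (fun s => x (sval s)) (exist _ i erefl).
have glueE X Y u x k (s : {i | c i = k}) :
    glue X Y u x (sval s) = u k (fun s => x (sval s)) s.
  by case: s => i e; case: k / e.
have glueK X Y u v : (forall k, cancel (u k) (v k)) ->
    cancel (glue X Y u) (glue Y X v).
  move=> uK x; apply: functional_extensionality_dep => i; rewrite /glue.
  have -> : (fun s : {j | c j = c i} =>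
      u (c (sval s)) (fun s' => x (sval s')) (exist _ (sval s) erefl)) =
      u (c i) (fun s => x (sval s)).
    by apply: functional_extensionality_dep => s; exact: (glueE X Y u x _ s).
  by rewrite uK.
exists (glue _ _ f); split.
  by exists (glue _ _ g); apply: glueK => k; have [] := gP k.
split=> [x y|a x]; apply: functional_extensionality_dep => i; rewrite /glue;
  by have [_ [fD fZ]] := fP (c i); rewrite ?fD ?fZ.
Qed.

Lemma prod_iso_const I (A B : I -> rmodType R) (a : I) :
  (forall i, i = a) -> mod_iso (A a) (B a) -> prod_iso A B.
Proof.
move=> all_a iso.
have /all_sig[f fP] i : {f : {linear A i -> B i} | bijective f}.
  by apply: cid; rewrite (all_a i).
have /all_sig[g gP] i : {g | cancel (f i) g /\ cancel g (f i)}.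
  by apply: cid; have [g fK gK] := fP i; exists g.
exists (fun x i => f i (x i)); split.
  exists (fun x i => g i (x i)) => x; apply: functional_extensionality_dep => i;
  by have [fK gK] := gP i.
by split=> [x y|b x]; apply: functional_extensionality_dep => i;
  rewrite ?linearD ?linearZ.
Qed.

Lemma prod_iso_bool (A B : bool -> rmodType R) :
  mod_iso (A true * A false)%type (B true * B false)%type -> prod_iso A B.
Proof.
move=> [f [g fK gK]].
pose pack (X : bool -> rmodType R) (x : X true * X false) b : X b :=
  if b return X b then x.1 else x.2.
exists (fun x => pack B (f (x true, x false))); split.
  exists (fun y => pack A (g (y true, y false))) => x;
    apply: functional_extensionality_dep => b;
    by rewrite /pack /= -surjective_pairing ?fK ?gK; case: b.
split=> [x y|a x]; apply: functional_extensionality_dep => b.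
  have -> : (x true + y true, x false + y false) =
            (x true, x false) + (y true, y false) by [].
  by rewrite linearD; case: b.
have -> : (a *: x true, a *: x false) = a *: (x true, x false) by [].
by rewrite linearZ; case: b.
Qed.

Lemma prod_iso_two I (A B : I -> rmodType R) (a b : I) :
  a <> b -> (forall i, i = a \/ i = b) ->
  mod_iso (A a * A b)%type (B a * B b)%type -> prod_iso A B.
Proof.
move=> ab all_ab iso.
pose h (t : bool) := if t then a else b.
have bij_h : bijective h.
  exists (fun i => `[< i = a >]) => [[]|i] /=.
  - exact/asboolP.
  - by apply/asboolPn => /esym.
  - by rewrite /h; case: asboolP => // ia; case: (all_ab i).
apply: prod_iso_trans (prod_iso_reindex _ _ B h bij_h).
apply: prod_iso_trans (prod_iso_sym _ _ _ _ (prod_iso_reindex _ _ A h bij_h)) _.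
exact: prod_iso_bool.
Qed.

Lemma prod_iso_involution I (A B : I -> rmodType R) (r : I -> I) :
  involutive r ->
  (forall i, r i = i -> mod_iso (A i) (B i)) ->
  (forall i, mod_iso (A i * A (r i))%type (B i * B (r i))%type) ->
  prod_iso A B.
Proof.
move=> rK iso1 iso2.
(* An orbit is encoded as the predicate of its members, so that [i] and [r i] get equal values. *)
pose c i := fun j : I => j = i \/ j = r i.
have cE i j : c i = c j -> j = i \/ j = r i.
  by move=> /(congr1 (@^~ j)); rewrite /c => ->; left.
apply: (prod_iso_gather _ _ _ _ c) => k.
(* A predicate [k] that is no orbit has an empty fibre, and both products over it are trivial. *)
have [[i0 ki0]|nk] := EM (exists i, c i = k); last first.
  pose no s : False := nk (ex_intro _ _ (svalP s)).
  exists (fun _ s => match no s with end); split; last first.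
    by split=> *; apply: functional_extensionality_dep => s; case: (no s).
  exists (fun _ s => match no s with end) => x;
    by apply: functional_extensionality_dep => s; case: (no s).
have kr : c (r i0) = k.
  rewrite -ki0; apply: funext => j; rewrite /c rK.
  by apply/propext; split=> -[]; auto.
pose a : {i | c i = k} := exist _ i0 ki0.
pose b : {i | c i = k} := exist _ (r i0) kr.
have sval_inj (s s' : {i | c i = k}) : sval s = sval s' -> s = s'.
  case: s s' => i e [j e'] /= ij; subst j.
  by congr exist; exact: Prop_irrelevance.
have all_ab s : s = a \/ s = b.
  have [ii|ii] : sval s = i0 \/ sval s = r i0 by apply: cE; rewrite (svalP s).
    by left; exact: sval_inj.
  by right; exact: sval_inj.
have [ri|nri] := EM (r i0 = i0).
  apply: (prod_iso_const _ _ _ a); last exact: iso1.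
  by move=> s; case: (all_ab s) => // ->; exact: sval_inj.
have ab : a <> b by move/(congr1 sval) => /= /esym.
exact: (prod_iso_two _ _ _ a b ab all_ab (iso2 i0)).
Qed.

End ProdIso.

(** * Inverting a permutation by an involution *)

(* Choosing a base point [b] in each orbit of [t], [r] sends [t^k b] to
   [t^-k b]; the relation [refl b i y] says so without negative powers. *)
Lemma inverting_involution (I : Type) (t t' : I -> I) :
  cancel t t' -> cancel t' t ->
  exists r : I -> I, [/\ involutive r, involutive (t' \o r) &
    forall i, exists n m, r i = iter m t' (iter n t i)].
Proof.
move=> tK t'K.
have itK n : cancel (iter n t) (iter n t').
  by elim: n => // n IHn i; rewrite (iterSr n t') iterS tK IHn.
have it'K n : cancel (iter n t') (iter n t).
  by elim: n => // n IHn i; rewrite (iterSr n t) iterS t'K IHn.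
have itC n m i : iter n t (iter m t i) = iter m t (iter n t i).
  by rewrite -!iterD addnC.
(* Lying in the same [t]-orbit. *)
pose conn i j := exists n m, iter n t i = iter m t j.
have conn_refl i : conn i i by exists 0%N, 0%N.
have conn_sym i j : conn i j -> conn j i by move=> [n [m e]]; exists m, n.
have conn_trans j i k : conn i j -> conn j k -> conn i k.
  move=> [n [m e]] [n' [m' e']]; exists (n' + n)%N, (m + m')%N.
  by rewrite iterD e itC e' -iterD.
have [base [baseP base_eq]] : exists base : I -> I,
    (forall i, conn i (base i)) /\ (forall i j, conn i j -> base i = base j).
  have ex i : exists j, conn i j by exists i.
  (* Connected points have equal orbit predicates, so by proof irrelevance the choice picks the same
     base point. *)
  have cid_eq (S S' : I -> Prop) (p : exists j, S j) (p' : exists j, S' j) :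
      S = S' -> sval (cid p) = sval (cid p').
    by move=> e; subst S'; rewrite (Prop_irrelevance p p').
  exists (fun i => sval (cid (ex i))); split=> [i|i j ij].
    exact: svalP (cid (ex i)).
  apply: cid_eq; apply: funext => k; apply: propext.
  by split; apply: conn_trans => //; exact: conn_sym.
pose refl b i y :=
  exists n m, iter n t i = iter m t b /\ iter m t y = iter n t b.
have refl_fun b i y y' : refl b i y -> refl b i y' -> y = y'.
  move=> [n [m [e1 e2]]] [n' [m' [e3 e4]]].
  apply: (can_inj (itK (m + m')%N)).
  by rewrite iterD itC e2 iterD e4 !(itC m') -e3 (itC m) -e1 itC.
have refl_sym b i y : refl b i y -> refl b y i.
  by move=> [n [m [e1 e2]]]; exists m, n.
have refl_shift b i y : refl b i y -> refl b (t i) (t' y).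
  move=> [n [m [e1 e2]]]; exists n, m.+1.
  by rewrite -iterSr iterS e1 (iterSr m t (t' y)) t'K.
have /all_sig[r rP] i : {y | refl (base i) i y}.
  apply: cid; have [n [m e]] := baseP i.
  (* Here [i] is [t^(m-n)] of the base point, so its reflection is [t^(n-m)] of it. *)
  by exists (iter m t' (iter n t (base i))), n, m; rewrite it'K.
have conn_r i : conn i (r i).
  have [n [m [e1 e2]]] := rP i; exists (n + n)%N, (m + m)%N.
  by rewrite iterD e1 itC -e2 -iterD.
have rK : involutive r.
  move=> i; apply: refl_fun (rP (r i)) _; apply: refl_sym.
  by rewrite -(base_eq i).
have rt i : r (t i) = t' (r i).
  apply: refl_fun (rP (t i)) _; rewrite -(base_eq i); last by exists 1%N, 0%N.
  exact: refl_shift.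
exists r; split=> // [i|i] /=.
  (* Since [t' r = r t], the square of [t' r] is [r t t' r = r r]. *)
  by rewrite -rt t'K rK.
have [n [m e]] := conn_r i; exists n, m; by rewrite e itK.
Qed.

(** * Permuted families *)

Section PermutedFamilies.
Context (R : pzRingType) (Ob : rmodType R -> Prop) (P Q : ideal_data R).
Context (HP : completely_prime Ob P) (HQ : completely_prime Ob Q).
Context (Haut : forall A : rmodType R, Ob A -> forall f : {linear A -> A},
  bijective f <-> ~ (P A A f \/ Q A A f)).
Context (Hdsp : DSP Ob).
Let trP := same_class_trans R Ob P HP.
Let trQ := same_class_trans R Ob Q HQ.
Let syP := same_class_sym R P.
Let syQ := same_class_sym R Q.

(** On an orbit of [r], the families have equal P-classes and Q-classes interchanged by [r]:
    [swap_iso] applies, or [mod_iso_of_classes] at a fixed point. *)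
Lemma prod_iso_swap I (X Y : I -> rmodType R) (r : I -> I) :
  involutive r -> (forall i, Ob (X i)) -> (forall i, Ob (Y i)) ->
  (forall i, same_class P (X i) (Y i)) ->
  (forall i, same_class Q (X i) (Y (r i))) ->
  prod_iso X Y.
Proof.
move=> rK oX oY XP XQ; apply: (prod_iso_involution R I X Y r rK) => i.
  move=> ri; apply: (mod_iso_of_classes R Ob P Q) => //.
  by rewrite -[X in Y X]ri.
apply: (swap_iso R Ob P Q) => //.
by rewrite -[X in Y X]rK.
Qed.

Lemma exchange_orbit I (A B : I -> rmodType R) (t t' : I -> I) :
  cancel t t' -> cancel t' t ->
  (forall i, Ob (A i)) -> (forall i, Ob (B i)) ->
  (forall i, same_class P (A i) (B i)) ->
  (forall i, same_class Q (A i) (B (t i))) ->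
  forall i n m, exists D,
    [/\ Ob D, same_class P D (B i) &
        same_class Q D (B (iter m t' (iter n t i)))].
Proof.
move=> tK t'K oA oB AP AQ i n m.
elim: m => [|m [D [oD DP DQ]]].
  elim: n => [|n [D [oD DP DQ]]].
    exists (B i); split=> //; first exact: (same_class_refl R Ob P HP).
    exact: (same_class_refl R Ob Q HQ).
  (* Splitting [B k] off [A k * D] leaves an object with the P-class of [D] and the Q-class of
     [A k], which is that of [B (t k)]. *)
  set k := iter n t i in DQ *.
  have [] := exchange R Ob P Q HP HQ Haut Hdsp (A k) D (B k) => //.
  - exact: syP.
  - exact: syQ.
  move=> E [oE _ EP EQ]; exists E; split=> //; first exact: (trP D).
  exact: (trQ (A k)).
(* Backwards, [A (t' k)] has the Q-class of [B k]; splitting it off [B (t' k) * D] leaves the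
   Q-class of [B (t' k)]. *)
set k := iter m t' _ in DQ *.
have [] := exchange R Ob P Q HP HQ Haut Hdsp (B (t' k)) D (A (t' k)) => //.
  by apply: (trQ (B k)) => //; [rewrite -[X in B X]t'K | exact: syQ].
move=> E [oE _ EP EQ]; exists E; split=> //; exact: (trP D).
Qed.

Lemma prod_iso_permuted I (A B : I -> rmodType R) (t : I -> I) :
  bijective t ->
  (forall i, Ob (A i)) -> (forall i, Ob (B i)) ->
  (forall i, same_class P (A i) (B i)) ->
  (forall i, same_class Q (A i) (B (t i))) ->
  prod_iso A B.
Proof.
move=> [t' tK t'K] oA oB AP AQ.
have [r [rK r'K r_orbit]] := inverting_involution I t t' tK t'K.
have /all_sig[C CP] i : {D | [/\ Ob D, same_class P D (B i) &
    same_class Q D (B (r i))]}.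
  apply: cid; have [n [m ->]] := r_orbit i.
  exact: (exchange_orbit I A B t t').
have oC i : Ob (C i) by have [] := CP i.
apply: (prod_iso_trans R _ _ _ _ C).
  (* [A] at [t' (r i)] has the Q-class of [B (r i)], which is that of [C i]. *)
  apply: prod_iso_sym; apply: (prod_iso_swap _ _ _ _ r'K) => // i;
    have [_ CiP CiQ] := CP i.
    by apply: (trP (B i)) => //; apply: syP.
  apply: (trQ (B (r i))) => //; apply: syQ.
  by rewrite -[X in B X]t'K; exact: AQ.
by apply: (prod_iso_swap _ _ _ _ rK) => // i; have [] := CP i.
Qed.

End PermutedFamilies.

Theorem theorem2p3 (R : pzRingType) (Ob : rmodType R -> Prop)
    (P Q : ideal_data R)
    (Hind : forall A : rmodType R, Ob A -> indecomposable A)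
    (HP : completely_prime Ob P) (HQ : completely_prime Ob Q)
    (Haut : forall A : rmodType R, Ob A -> forall f : {linear A -> A},
        bijective f <-> ~ (P A A f \/ Q A A f))
    (Hdsp : DSP Ob)
    (I J : Type) (A : I -> rmodType R) (B : J -> rmodType R)
    (HA : forall i, Ob (A i)) (HB : forall j, Ob (B j))
    (sigma tau : I -> J) (Hsigma : bijective sigma) (Htau : bijective tau)
    (HPs : forall i, same_class P (A i) (B (sigma i)))
    (HQt : forall i, same_class Q (A i) (B (tau i))) :
  prod_iso A B.
Proof.
move: Hsigma Htau => [s sK s'K] [u uK u'K].
(* After reindexing [B] by [sigma], the permutation of the Q-classes is the inverse of [sigma] after
   [tau]. *)
apply: prod_iso_trans (prod_iso_reindex R I J B sigma _); last by exists s.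
apply: (prod_iso_permuted R Ob P Q HP HQ Haut Hdsp _ _ _ (s \o tau)) => //=.
  by apply: bij_comp; [exists sigma | exists u].
by move=> i; rewrite s'K.
Qed.
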